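(* No irreducible explicit SSP-TS two-derivative multistage method can have order $p=7$.
   Context: An explicit $s$-stage two-derivative multistage method has coefficients given by strictly lower triangular real $s\times s$ matrices $A=(a_{ij})$, $\hat A=(\hat a_{ij})$ and vectors $b,\hat b\in\mathbb{R}^s$, and reads, for an ODE $u_t=F(u)$ with second derivative $u_{tt}=\dot F(u)=F'(u)F(u)$: $y^{(1)}=u^n$, $$y^{(i)}=u^n+\Delta t\sum_{j=1}^{i-1}a_{ij}F(y^{(j)})+\Delta t^2\sum_{j=1}^{i-1}\hat a_{ij}\dot F(y^{(j)}),\quad i=2,\dots,s,$$ $$u^{n+1}=u^n+\Delta t\sum_{j=1}^{s}b_jF(y^{(j)})+\Delta t^2\sum_{j=1}^{s}\hat b_j\dot F(y^{(j)}).$$ The method has order $p$ if for every sufficiently smooth $F$ the one-step (local) error is $O(\Delta t^{p+1})$. Put $S=\begin{bmatrix}A&\mathbf 0\\ b^T&0\end{bmatrix}$, $\hat S=\begin{bmatrix}\hat A&\mathbf 0\\ \hat b^T&0\end{bmatrix}$ (both $(s+1)\times(s+1)$) and let $\mathbf e$ be the vector of ones. SSP-TS: the method is called SSP-TS (strong stability preserving Taylor series), for a given constant $K>0$, if there is $r_{max}>0$ such that for all $r\in(0,r_{max}]$, component-wise, $$\left(I+rS+\tfrac{2r^2}{K^2}(1-K)\hat S\right)^{-1}\mathbf{e}\ge 0,\quad r\left(I+rS+\tfrac{2r^2}{K^2}(1-K)\hat S\right)^{-1}\left(S-\tfrac{2r}{K}\hat S\right)\ge 0,\quad \tfrac{2r^2}{K^2}\left(I+rS+\tfrac{2r^2}{K^2}(1-K)\hat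 S\right)^{-1}\hat S\ge 0 .$$ Irreducibility: the method is DJ-reducible if there are sets $T_1,T_2$ with $T_1\neq\emptyset$, $T_1\cap T_2=\emptyset$, $T_1\cup T_2=\{1,\dots,s\}$, such that $b_j=\hat b_j=0$ for $j\in T_1$ and $a_{ij}=\hat a_{ij}=0$ for $i\in T_2$, $j\in T_1$. It is irreducible if it is not DJ-reducible. *)

(* Defs.v *)
From HB Require Import structures.
From mathcomp Require Import all_boot all_order all_algebra.
From mathcomp Require Import all_classical all_reals all_analysis.
Import Order.TTheory GRing.Theory Num.Theory numFieldNormedType.Exports.

Set Implicit Arguments.
Unset Strict Implicit.
Unset Printing Implicit Defensive.

Local Open Scope classical_set_scope.
Local Open Scope ring_scope.

Definition strictly_lower (R : realType) (s : nat) (A : 'M[R]_s) : Prop :=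
  forall i j : 'I_s, (i <= j)%N -> A i j = 0.

Record explicit_tdmm (R : realType) (s : nat) := ExplicitTDMM {
  tdA : 'M[R]_s;
  tdAhat : 'M[R]_s;
  tdb : 'cV[R]_s;
  tdbhat : 'cV[R]_s;
  tdA_lower : strictly_lower tdA;
  tdAhat_lower : strictly_lower tdAhat }.

(* On R^d, [C_k k] is the usual class C^k of functions: F is C^(k+1) iff it is
   differentiable and all the maps x |-> F'(x) v, with v fixed, are C^k. *)
Fixpoint C_k (R : realType) (d : nat) (k : nat)
    (F : 'rV[R]_d -> 'rV[R]_d) : Prop :=
  match k with
  | 0 => continuous F
  | k'.+1 => (forall x, differentiable F x) /\
             (forall v, C_k k' (fun x => 'd F x v))
  end.

Definition smooth (R : realType) (d : nat) (F : 'rV[R]_d -> 'rV[R]_d) : Prop :=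
  forall k, C_k k F.

Definition Fdot (R : realType) (d : nat) (F : 'rV[R]_d -> 'rV[R]_d)
  (x : 'rV[R]_d) : 'rV[R]_d := 'd F x (F x).

Section Method.
Variables (R : realType) (s : nat) (M : explicit_tdmm R s).

(* The system is triangular, so it has exactly one solution y for given F, u
   and h: see [is_stages_exists] and [is_stages_unique]. *)
Definition is_stages (d : nat) (F : 'rV[R]_d -> 'rV[R]_d) (u : 'rV[R]_d)
    (h : R) (y : 'I_s -> 'rV[R]_d) : Prop :=
  forall i : 'I_s,
    y i = u + h *: (\sum_(j < s | (j < i)%N) tdA M i j *: F (y j))
            + h ^+ 2 *: (\sum_(j < s | (j < i)%N) tdAhat M i j *: Fdot F (y j)).

Definition step (d : nat) (F : 'rV[R]_d -> 'rV[R]_d) (u : 'rV[R]_d)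
    (h : R) (y : 'I_s -> 'rV[R]_d) : 'rV[R]_d :=
  u + h *: (\sum_(j < s) tdb M j 0 *: F (y j))
    + h ^+ 2 *: (\sum_(j < s) tdbhat M j 0 *: Fdot F (y j)).

Definition has_order (p : nat) : Prop :=
  forall (d : nat) (F : 'rV[R]_d -> 'rV[R]_d), smooth F ->
  forall u : R -> 'rV[R]_d,
    (\forall t \near (0 : R), is_derive t (1 : R) u (F (u t))) ->
  forall y : R -> 'I_s -> 'rV[R]_d,
    (forall h : R, is_stages F (u 0) h (y h)) ->
  exists C : R, \forall h \near 0^'+,
    `|u h - step F (u 0) h (y h)| <= C * h ^+ p.+1.

Definition S_mx : 'M[R]_(s + 1) := block_mx (tdA M) 0 (tdb M)^T 0.
Definition Shat_mx : 'M[R]_(s + 1) := block_mx (tdAhat M) 0 (tdbhat M)^T 0.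

Definition mx_ge0 (m n : nat) (B : 'M[R]_(m, n)) : Prop :=
  forall i j, 0 <= B i j.

Definition ssp_resolvent_mx (K r : R) : 'M[R]_(s + 1) :=
  1%:M + r *: S_mx + (2 * r ^+ 2 / K ^+ 2 * (1 - K)) *: Shat_mx.

(* [S_mx] and [Shat_mx] are strictly lower triangular, so [ssp_resolvent_mx] is
   always invertible and [invmx] is its inverse: see
   [ssp_resolvent_mx_unit]. *)
Definition ssp_ts (K : R) : Prop :=
  exists2 rmax : R, 0 < rmax &
    forall r : R, 0 < r -> r <= rmax ->
      let Q := invmx (ssp_resolvent_mx K r) in
      [/\ mx_ge0 (Q *m (const_mx 1 : 'cV[R]_(s + 1))),
          mx_ge0 (r *: (Q *m (S_mx - (2 * r / K) *: Shat_mx))) &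
          mx_ge0 ((2 * r ^+ 2 / K ^+ 2) *: (Q *m Shat_mx))].

Definition dj_reducible : Prop :=
  exists T1 T2 : {set 'I_s},
    [/\ T1 != finset.set0, T1 :&: T2 = finset.set0, T1 :|: T2 = finset.setT,
        (forall j, j \in T1 -> tdb M j 0 = 0 /\ tdbhat M j 0 = 0) &
        (forall i j, i \in T2 -> j \in T1 ->
           tdA M i j = 0 /\ tdAhat M i j = 0)].

Definition irreducible : Prop := ~ dj_reducible.

Lemma is_stages_unique (d : nat) (F : 'rV[R]_d -> 'rV[R]_d) u h y z :
  is_stages F u h y -> is_stages F u h z -> y =1 z.
Proof.
move=> Hy Hz i; have [n] := ubnP (val i); elim: n i => // n IH i /= ltin.
by rewrite Hy Hz; congr (_ + _ *: _ + _ *: _); apply: eq_bigr => j ji;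
  rewrite IH// (leq_trans ji).
Qed.

Lemma is_stages_exists (d : nat) (F : 'rV[R]_d -> 'rV[R]_d) u h :
  exists y, is_stages F u h y.
Proof.
pose Phi (y : 'I_s -> 'rV[R]_d) (i : 'I_s) : 'rV[R]_d :=
  u + h *: (\sum_(j < s | (j < i)%N) tdA M i j *: F (y j))
    + h ^+ 2 *: (\sum_(j < s | (j < i)%N) tdAhat M i j *: Fdot F (y j)).
pose Y n := iter n Phi (fun=> u).
have YE n (i : 'I_s) : (i < n)%N -> Y n i = Y n.+1 i.
  elim: n i => // n IH i ltin.
  change (Phi (Y n) i = Phi (Y n.+1) i); rewrite /Phi.
  by congr (_ + _ *: _ + _ *: _); apply: eq_bigr => j ji;
    rewrite IH// (leq_trans ji).
by exists (Y s) => i; rewrite YE.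
Qed.

Lemma ssp_resolvent_mx_unit (K r : R) : ssp_resolvent_mx K r \in unitmx.
Proof.
have E : ssp_resolvent_mx K r =
  block_mx (1%:M + r *: tdA M + (2 * r ^+ 2 / K ^+ 2 * (1 - K)) *: tdAhat M) 0
    (r *: (tdb M)^T + (2 * r ^+ 2 / K ^+ 2 * (1 - K)) *: (tdbhat M)^T) 1%:M.
  rewrite /ssp_resolvent_mx /S_mx /Shat_mx scalar_mx_block !scale_block_mx.
  by rewrite !add_block_mx !scaler0 !addr0 add0r.
rewrite unitmxE E det_lblock det1 mulr1 det_trig.
  rewrite big1 ?unitr1// => i _.
  by rewrite !mxE eqxx tdA_lower// tdAhat_lower// !mulr0 !addr0.
apply/is_trig_mxP => i j ij.
rewrite !mxE tdA_lower ?tdAhat_lower ?(ltnW ij)//.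
by rewrite -val_eqE (ltn_eqF ij) !mulr0 !addr0.
Qed.

End Method.

(* Main.v *)
From HB Require Import structures.
Require Import Defs.
From mathcomp Require Import all_boot all_order all_algebra.
From mathcomp Require Import all_classical all_reals all_analysis.
From mathcomp Require Import ring.
Import Order.TTheory GRing.Theory Num.Theory numFieldNormedType.Exports.

(** Two facts collide.

    The SSP condition together with irreducibility forces all weights [b_j] to
    be positive ([irreducible_ssp_weights_gt0]).  Write [N] for the strictly
    lower triangular part of the resolvent matrix [V = I + N] at one admissible
    step [r], and [P], [W] for the two matrices that the condition requires to
    be nonnegative besides [V^-1 e].  Then [P + W = V^-1 N = I - V^-1], so that
    [V] is the Neumann series of the nonnegative matrix [B = P + W], while [S]
    and [Shat] are positive multiples of [V (P + K W)] and [V W].  Hence the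
    support of [V] is the reflexive transitive closure of the graph of [B].
    The stages that the last row of [V] does not reach form a set along which
    the method is DJ-reducible; so every stage is reached, which says that every
    entry of [b] is positive.

    On the other hand, consider the polynomial problem
      [x' = 1,  z' = x^2/2,  w' = (z - x^3/6)^2],  zero at time 0,
    with exact solution [(t, t^3/6, 0)].  The second derivative of [w] vanishes
    identically, and the stages are exactly [x_i = h c_i] and
    [z_i = h^3 sigma_i] with [sigma = A c^2/2 + Ahat c].  The numerical [w] is
    therefore exactly [h^7 \sum_j b_j (sigma_j - c_j^3/6)^2], and order 7 makes
    this sum vanish.  With [b > 0], each [sigma_j] equals [c_j^3/6].  For an
    explicit method, [sigma_j] only involves the earlier abscissae, so by
    induction all [c_j] vanish: no stage ever leaves time 0.  But then the
    numerical [z] is 0 although the exact one is [h^3/6]. *)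

Set Implicit Arguments.
Unset Strict Implicit.
Unset Printing Implicit Defensive.

Local Open Scope classical_set_scope.
Local Open Scope ring_scope.

(** * Neumann series of nonnegative strictly lower triangular matrices *)

Section NonnegativeLower.
Variables (R : realType) (m : nat).
Implicit Types A B N V : 'M[R]_m.

(** Row [i] of [N = B + N B] expresses row [i] of [B] by earlier rows of [B]. *)
Lemma strictly_lower_quotient N B :
  strictly_lower N -> N = (1%:M + N) *m B -> strictly_lower B.
Proof.
move=> lN NB i; have [n] := ubnP (val i); elim: n i => // n IH i /= ltin j ij.
have: N i j = ((1%:M + N) *m B) i j by rewrite -NB.
rewrite lN // mulmxDl mul1mx mxE [X in _ + X]mxE big1 ?addr0 // => k _.
have [ki|ik] := ltnP k i; last by rewrite lN // mul0r.
by rewrite IH ?mulr0 // ?(leq_trans ki) // ltnW // (leq_trans ki).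
Qed.

(** The equation says that [V] is the sum of the powers of [B]; strict
    triangularity turns it into a recursion on rows with nonnegative terms, so
    no series has to be summed. *)
Lemma neumann_ge0 B V :
  strictly_lower B -> mx_ge0 B -> V = 1%:M + B *m V -> mx_ge0 V.
Proof.
move=> lB B0 VE i; have [n] := ubnP (val i); elim: n i => // n IH i /= ltin j.
rewrite VE !mxE addr_ge0 // ?ler0n //; apply: sumr_ge0 => k _.
have [ki|ik] := ltnP k i; last by rewrite lB // mul0r.
by rewrite mulr_ge0 // IH // (leq_trans ki).
Qed.

Lemma mulmx_ge0_eq0 A B i j : mx_ge0 A -> mx_ge0 B ->
  (A *m B) i j = 0 -> forall k, A i k != 0 -> B k j = 0.
Proof.
move=> A0 B0; rewrite mxE => /eqP; rewrite psumr_eq0; last first.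
  by move=> k _; rewrite mulr_ge0.
move=> /allP AB0 k /negPf Aik; apply/eqP.
by have := AB0 k (mem_index_enum _); rewrite /= mulf_eq0 Aik.
Qed.

(** Read [V n k != 0] as: [k] can be reached from [n] in the graph of [B].  The
    reachable set is stable under the edges of [B], because an edge out of it
    would contribute a positive term to [V n l]. *)
Lemma neumann_support_closed B V n k l : mx_ge0 B -> mx_ge0 V ->
  V = 1%:M + V *m B -> V n k != 0 -> V n l = 0 -> B k l = 0.
Proof.
move=> B0 V0 VE Vk Vl; apply: (mulmx_ge0_eq0 V0 B0 _ Vk); apply/eqP.
have VB0 : 0 <= (V *m B) n l.
  by rewrite mxE; apply: sumr_ge0 => a _; exact: mulr_ge0.
have := Vl; rewrite [in X in X -> _]VE mxE mxE => /eqP.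
by rewrite paddr_eq0 ?ler0n // => /andP[].
Qed.

(** Reachability is transitive: a path that starts inside the reachable set of
    [n] never leaves it. *)
Lemma neumann_support_trans B V n i j : strictly_lower B -> mx_ge0 B ->
  V = 1%:M + B *m V -> V = 1%:M + V *m B ->
  V n i != 0 -> V n j = 0 -> V i j = 0.
Proof.
move=> lB B0 VE VE' Vi Vj; have V0 := neumann_ge0 lB B0 VE.
have [a] := ubnP (val i); elim: a i Vi => // a IH i Vi /= ltia.
rewrite VE mxE mxE.
have -> /= : (i == j) = false by apply/eqP => ij; move: Vi; rewrite ij Vj eqxx.
rewrite add0r mxE big1 // => k _.
have [ki|ik] := ltnP k i; last by rewrite lB // mul0r.
have [Vk|Vk] := eqVneq (V n k) 0.
  by rewrite (neumann_support_closed B0 V0 VE' Vi Vk) mul0r.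
by rewrite (IH k) ?mulr0 // (leq_trans ki).
Qed.

End NonnegativeLower.

(** * Positivity of the weights *)

Section PositiveWeights.
Variables (R : realType) (s : nat) (M : explicit_tdmm R s) (K : R).

Lemma strictly_lower_block (A : 'M[R]_s) (b : 'cV[R]_s) :
  strictly_lower A -> strictly_lower (block_mx A 0 b^T 0 : 'M[R]_(s + 1)).
Proof.
move=> lA i j; case: (split_ordP i) => i' ->; case: (split_ordP j) => j' ->.
- by rewrite block_mxEul => /lA.
- by rewrite block_mxEur mxE.
- by rewrite /= leqNgt (leq_trans (ltn_ord j')) // leq_addr.
- by rewrite block_mxEdr mxE.
Qed.

(** A modified Shu-Osher form of the method.  The terms in [Shat] of [N] are
    arranged so that [P + W = V^-1 N]; solving the definitions of [P] and [W]
    for [S] and [Shat] gives positive combinations, whatever the sign of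
    [1 - K]. *)
Lemma ssp_nonneg_form : 0 < K -> ssp_ts M K ->
  exists (P W V : 'M[R]_(s + 1)) (p q : R),
    [/\ mx_ge0 P, mx_ge0 W & strictly_lower (P + W)] /\
    [/\ V = 1%:M + (P + W) *m V, V = 1%:M + V *m (P + W), 0 < p,
        S_mx M = p *: (V *m (P + K *: W)) & Shat_mx M = q *: (V *m W)].
Proof.
move=> K0 [r r0 /(_ r r0 (lexx r))] /=.
have := ssp_resolvent_mx_unit M K r.
set V := ssp_resolvent_mx M K r => uV [_ P0 W0].
set P := (X in mx_ge0 X) in P0; set W := (X in mx_ge0 X) in W0.
pose N := r *: S_mx M + (2 * r ^+ 2 / K ^+ 2 * (1 - K)) *: Shat_mx M.
have VN : V = 1%:M + N by rewrite /V /ssp_resolvent_mx addrA.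
have rn0 : r != 0 by rewrite gt_eqF.
have Kn0 : K != 0 by rewrite gt_eqF.
have PWE : P + W = invmx V *m N.
  rewrite /P /W /N mulmxBr mulmxDr -!scalemxAr scalerBr scalerA -addrA.
  rewrite -scaleNr -scalerDl.
  by congr (_ + _ *: _); field.
have NV : N *m V = V *m N by rewrite VN mulmxDl mulmxDr mul1mx mulmx1.
have NE : N = V *m (P + W) by rewrite PWE mulKVmx.
have lN : strictly_lower N.
  have lS := strictly_lower_block (tdb M) (@tdA_lower _ _ M).
  have lSh := strictly_lower_block (tdbhat M) (@tdAhat_lower _ _ M).
  move=> i j ij; rewrite mxE [X in X + _]mxE [X in _ + X]mxE lS // lSh //.
  by rewrite !mulr0 addr0.
exists P, W, V, r^-1, (K ^+ 2 / (2 * r ^+ 2)); split; split=> //.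
- by apply: (strictly_lower_quotient lN); rewrite -VN.
- by rewrite PWE -mulmxA NV mulKmx.
- by rewrite -NE.
- by rewrite invr_gt0.
- rewrite mulmxDr /P /W -!scalemxAr !mulKVmx //.
  apply/matrixP => i j; move: (S_mx M) (Shat_mx M) => S Sh; rewrite !mxE.
  have key (x y : R) : x =
      r^-1 * (r * (x - 2 * r / K * y) + K * (2 * r ^+ 2 / K ^+ 2 * y)).
    by field; rewrite Kn0 rn0.
  exact: key.
- rewrite /W -scalemxAr mulKVmx // scalerA.
  by rewrite [X in X *: _](_ : _ = 1) ?scale1r //; field; rewrite Kn0 rn0.
Qed.

(** Reducing along the unreached stages shows that every stage [j] is reached
    from the row [n] of the weights; since [j <> n], the last edge of a path to
    [j] is an entry of [P] or of [W], and both contribute positively to [b_j]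
    (for [W] because [K > 0]). *)
Lemma irreducible_ssp_weights_gt0 :
  0 < K -> irreducible M -> ssp_ts M K -> forall j, 0 < tdb M j 0.
Proof.
move=> K0 irr /(ssp_nonneg_form K0).
move=> [P [W [V [p [q [[P0 W0 lB] [VE VE' p0 SE ShE]]]]]]].
pose n : 'I_(s + 1) := rshift s ord0.
have B0 : mx_ge0 (P + W) by move=> i j; rewrite mxE addr_ge0.
have V0 := neumann_ge0 lB B0 VE.
have C0 : mx_ge0 (P + K *: W).
  by move=> i j; rewrite !mxE addr_ge0 // mulr_ge0 // ltW.
have bE j : tdb M j 0 = p * (V *m (P + K *: W)) n (lshift 1 j).
  have /matrixP/(_ n (lshift 1 j)) := SE.
  by rewrite block_mxEdl mxE => ->; rewrite mxE.
have bhE j : tdbhat M j 0 = q * (V *m W) n (lshift 1 j).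
  have /matrixP/(_ n (lshift 1 j)) := ShE.
  by rewrite block_mxEdl mxE => ->; rewrite mxE.
have aE i j : tdA M i j = p * (V *m (P + K *: W)) (lshift 1 i) (lshift 1 j).
  have /matrixP/(_ (lshift 1 i) (lshift 1 j)) := SE.
  by rewrite block_mxEul => ->; rewrite mxE.
have ahE i j : tdAhat M i j = q * (V *m W) (lshift 1 i) (lshift 1 j).
  have /matrixP/(_ (lshift 1 i) (lshift 1 j)) := ShE.
  by rewrite block_mxEul => ->; rewrite mxE.
have PW0 k l : (P + W) k l = 0 -> P k l = 0 /\ W k l = 0.
  by move=> /eqP; rewrite mxE paddr_eq0 // => /andP[/eqP ? /eqP].
have zero i j : (forall k, V i k != 0 -> V n k != 0) -> V n j = 0 ->
    (V *m (P + K *: W)) i j = 0 /\ (V *m W) i j = 0.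
  move=> Vi Vj; split; rewrite mxE big1 // => k _;
    have [->|Vik] := eqVneq (V i k) 0; rewrite ?mul0r //;
    have [Pk Wk] := PW0 _ _ (neumann_support_closed B0 V0 VE' (Vi _ Vik) Vj).
    by rewrite !mxE Pk Wk mulr0 addr0 mulr0.
  by rewrite Wk mulr0.
have reach j : V n (lshift 1 j) != 0.
  apply/negP => Vj; apply: irr.
  pose T : {set 'I_s} := [set i | V n (lshift 1 i) == 0]%SET.
  exists T, (~: T)%SET; split.
  - by apply/set0Pn; exists j; rewrite inE.
  - exact: finset.setICr.
  - exact: finset.setUCr.
  - move=> i; rewrite inE => /eqP Vi; rewrite bE bhE.
    by have [-> ->] := zero n _ (fun _ => id) Vi; rewrite !mulr0.
  - move=> i l; rewrite !inE => Vi /eqP Vl; rewrite aE ahE.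
    have [|-> ->] := zero (lshift 1 i) _ _ Vl; last by rewrite !mulr0.
    move=> k; apply: contra_neq => Vk.
    exact: neumann_support_trans lB B0 VE VE' Vi Vk.
move=> j; rewrite bE mulr_gt0 // lt_def; apply/andP; split; last first.
  by rewrite mxE; apply: sumr_ge0 => k _; rewrite mulr_ge0.
apply: contra (reach j) => /eqP VC0; rewrite VE' mxE mxE.
have -> /= : (n == lshift 1 j) = false by rewrite eq_sym eq_lrshift.
rewrite add0r mxE big1 // => k _.
have [->|Vk] := eqVneq (V n k) 0; first by rewrite mul0r.
have /eqP := mulmx_ge0_eq0 V0 C0 VC0 Vk; rewrite !mxE.
rewrite paddr_eq0 // ?mulr_ge0 // ?ltW // mulf_eq0 (gt_eqF K0) /=.
by move=> /andP[/eqP -> /eqP ->]; rewrite addr0 mulr0.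
Qed.

End PositiveWeights.

(** * Polynomial maps are smooth *)

Section PolynomialMaps.
Variable R : realType.

(** A syntactic class of functions, stable under directional derivatives; this
    stability is what makes its members smooth. *)
Inductive polyfun (V : normedModType R) : (V -> R) -> Prop :=
| PolyCst c : polyfun (fun=> c)
| PolyLin (f : {linear V -> R}) : continuous f -> polyfun f
| PolyAdd f g : polyfun f -> polyfun g -> polyfun (fun x => f x + g x)
| PolyMul f g : polyfun f -> polyfun g -> polyfun (fun x => f x * g x).

Lemma polyfun_diff (V : normedModType R) (f : V -> R) : polyfun f ->
  (forall x, differentiable f x) /\ forall v, polyfun (fun x => 'd f x v).
Proof.
elim=> [c|g cg|g h _ [dg pg] _ [dh ph]|g h pg [dg dpg] ph [dh dph]].
- split=> [x|v]; first exact: differentiable_cst.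
  rewrite [X in polyfun X](_ : _ = fun=> 0); first exact: PolyCst.
  by apply/funext => x; rewrite diff_cst.
- split=> [x|v]; first exact: linear_differentiable.
  rewrite [X in polyfun X](_ : _ = fun=> g v); first exact: PolyCst.
  by apply/funext => x; rewrite diff_lin.
- split=> [x|v]; first exact: differentiableD.
  rewrite [X in polyfun X](_ : _ = fun x => 'd g x v + 'd h x v).
    exact: PolyAdd.
  by apply/funext => x; rewrite (diffD (dg x) (dh x)).
- split=> [x|v]; first exact: differentiableM.
  rewrite [X in polyfun X](_ : _ = fun x => g x * 'd h x v + h x * 'd g x v).
    by apply: PolyAdd; exact: PolyMul.
  by apply/funext => x; rewrite (diffM (dg x) (dh x)).
Qed.

Variable d : nat.

(** Differentiation rules ask for a bundled linear map, which the bare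
    coordinate function is not. *)
Lemma coord_linear_continuous (i : 'I_d) :
  exists2 f : {linear 'rV[R]_d -> R}, continuous f & forall x, f x = x 0 i.
Proof.
have lin : linear (fun y : 'rV[R]_d => y 0 i : R) by move=> a u v; rewrite !mxE.
pose L : {linear 'rV[R]_d -> R} :=
  HB.pack (fun y : 'rV[R]_d => y 0 i : R) (GRing.isLinear.Build _ _ _ _ _ lin).
by exists L => //; exact: coord_continuous.
Qed.

Lemma polyfun_coord (i : 'I_d) : polyfun (fun x : 'rV[R]_d => x 0 i).
Proof.
have [f cf fE] := coord_linear_continuous i.
by rewrite -(funext fE); exact: PolyLin.
Qed.

Lemma diff_coord (F : 'rV[R]_d -> 'rV[R]_d) x v i : differentiable F x ->
  ('d F x v) 0 i = 'd (fun y => F y 0 i) x v.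
Proof.
move=> dF; have [f cf fE] := coord_linear_continuous i.
rewrite (_ : (fun y => F y 0 i) = f \o F); last first.
  by apply/funext => y; rewrite /= fE.
rewrite (@diff_comp _ _ _ _ F f) //; last exact: linear_differentiable.
by rewrite /= diff_lin // fE.
Qed.

Lemma differentiable_rV (F : 'rV[R]_d -> 'rV[R]_d) x :
  (forall i, differentiable (fun y : 'rV[R]_d => F y 0 i) x) ->
  differentiable F x.
Proof.
move=> dF; have -> : F = \sum_(i < d) (fun y => F y 0 i *: delta_mx 0 i).
  by apply/funext => y; rewrite fct_sumE [LHS]matrix_sum_delta big_ord1.
by apply: differentiable_sum => i; exact: differentiableZl.
Qed.

Lemma polymap_smooth (F : 'rV[R]_d -> 'rV[R]_d) :
  (forall i, polyfun (fun x : 'rV[R]_d => F x 0 i)) -> smooth F.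
Proof.
move=> pF k; elim: k F pF => [|k IH] F pF.
  move=> x; apply/differentiable_continuous/differentiable_rV => i.
  exact: (polyfun_diff (pF i)).1.
have dF x : differentiable F x.
  by apply: differentiable_rV => i; exact: (polyfun_diff (pF i)).1.
split=> // v; apply: IH => i.
rewrite (_ : (fun x => _) = fun x => 'd (fun y : 'rV[R]_d => F y 0 i) x v).
  exact: (polyfun_diff (pF i)).2.
by apply/funext => x; rewrite diff_coord.
Qed.

End PolynomialMaps.

(** * The test problem *)

Section TestProblem.
Variable R : realType.

Definition ix : 'I_3 := @Ordinal 3 0 isT.
Definition iz : 'I_3 := @Ordinal 3 1 isT.
Definition iw : 'I_3 := @Ordinal 3 2 isT.

Definition row3 (a b c : R) : 'rV[R]_3 := \row_j [:: a; b; c]`_j.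

Definition test_field (p : 'rV[R]_3) : 'rV[R]_3 :=
  row3 1 (2^-1 * p 0 ix ^+ 2) ((p 0 iz - 6^-1 * p 0 ix ^+ 3) ^+ 2).

Definition test_sol (t : R) : 'rV[R]_3 := row3 t (6^-1 * t ^+ 3) 0.

Lemma forall_I3 (P : 'I_3 -> Prop) : P ix -> P iz -> P iw -> forall i, P i.
Proof.
move=> Px Pz Pw [[|[|[|//]]] lti].
- by rewrite (_ : Ordinal lti = ix) //; exact: val_inj.
- by rewrite (_ : Ordinal lti = iz) //; exact: val_inj.
- by rewrite (_ : Ordinal lti = iw) //; exact: val_inj.
Qed.

Lemma row3E a b c :
  (row3 a b c 0 ix = a) * (row3 a b c 0 iz = b) * (row3 a b c 0 iw = c).
Proof. by rewrite !mxE. Qed.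

Lemma test_field_smooth : smooth test_field.
Proof.
have px := polyfun_coord R ix; have pz := polyfun_coord R iz.
have pc c : polyfun (fun _ : 'rV[R]_3 => c) by exact: PolyCst.
apply: polymap_smooth; apply: forall_I3.
- by rewrite (_ : (fun _ => _) = fun=> 1) //; apply/funext => p; rewrite row3E.
- rewrite (_ : (fun _ => _) = fun p : 'rV[R]_3 => 2^-1 * (p 0 ix * p 0 ix)).
    by do 2?apply: PolyMul.
  by apply/funext => p; rewrite row3E expr2.
- rewrite (_ : (fun _ => _) = fun p : 'rV[R]_3 =>
     (p 0 iz + - 6^-1 * (p 0 ix * (p 0 ix * p 0 ix))) *
     (p 0 iz + - 6^-1 * (p 0 ix * (p 0 ix * p 0 ix)))).
    by do ?[exact: pc|exact: px|exact: pz|apply: PolyMul|apply: PolyAdd].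
  by apply/funext => p; rewrite row3E; ring.
Qed.

(** The last component is zero because [z - x^3/6] is a first integral of the
    first two equations; so the numerical [w] is a combination of squares with
    coefficients [b_j] only. *)
Lemma test_Fdot p : Fdot test_field p = row3 0 (p 0 ix) 0.
Proof.
have dF : differentiable test_field p by exact: (test_field_smooth 1).1.
have dcoord (i : 'I_3) : is_diff p (fun y : 'rV[R]_3 => y 0 i : R)
    (fun v : 'rV[R]_3 => v 0 i).
  have [f cf fE] := coord_linear_continuous R i.
  rewrite -(funext fE); apply: DiffDef; first exact: linear_differentiable.
  exact: diff_lin.
have dx := dcoord ix; have dz := dcoord iz.
apply/rowP; apply: forall_I3; rewrite /Fdot diff_coord //.
- rewrite (_ : (fun _ => _) = fun=> 1); first by rewrite diff_cst row3E.
  by apply/funext => q; rewrite row3E.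
- rewrite (_ : (fun _ => _) = 2^-1 *: (fun q : 'rV[R]_3 => q 0 ix : R) ^+ 2).
    rewrite diff_val row3E.
    change (2^-1 * ((2 * p 0 ix ^+ 1) * test_field p 0 ix) = p 0 ix).
    by rewrite row3E; field.
  by apply/funext => q; rewrite row3E.
- rewrite (_ : (fun _ => _) = ((fun q : 'rV[R]_3 => q 0 iz : R) -
      6^-1 *: (fun q : 'rV[R]_3 => q 0 ix : R) ^+ 3) ^+ 2).
    rewrite diff_val row3E.
    change (2 * (p 0 iz - 6^-1 * p 0 ix ^+ 3) ^+ 1 *
      (test_field p 0 iz - 6^-1 * (3 * p 0 ix ^+ 2 * test_field p 0 ix)) = 0).
    by rewrite !row3E; field.
  by apply/funext => q; rewrite row3E.
Qed.

Lemma test_sol_derive (t : R) :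
  is_derive t (1 : R) test_sol (test_field (test_sol t)).
Proof.
have d : forall i, is_derive t (1 : R) (fun x => test_sol x 0 i)
    (test_field (test_sol t) 0 i).
  apply: forall_I3.
  - rewrite (_ : (fun _ => _) = id).
      by rewrite !row3E; exact: is_derive_id.
    by apply/funext => q; rewrite row3E.
  - rewrite (_ : (fun _ => _) = 6^-1 *: (id : R -> R) ^+ 3).
      by apply: is_derive_eq; rewrite !row3E /GRing.scale /=; field.
    by apply/funext => q; rewrite row3E.
  - rewrite (_ : (fun _ => _) = cst 0).
      by rewrite !row3E subrr expr0n; exact: is_derive_cst.
    by apply/funext => q; rewrite row3E.
have dM : derivable test_sol t 1.
  by apply/derivable_mxP => i j; rewrite ord1; exact: ex_derive.
apply: DeriveDef => //; rewrite derive_mx //; apply/rowP => i; rewrite mxE.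
exact: derive_val.
Qed.

End TestProblem.

(** * Consequences of order seven *)

Lemma near0_pow_eq0 (R : realType) (a C : R) (m n : nat) : (m < n)%N ->
  (\forall h \near 0^'+, `|a * h ^+ m| <= C * h ^+ n) -> a = 0.
Proof.
move=> mn H; apply/eqP; rewrite -normr_le0; apply/ler_addgt0Pl => e e0.
rewrite addr0.
have D0 : 0 < `|C| + 1 by rewrite ltr_wpDl.
near ((0 : R)^'+) => h.
have h0 : 0 < h by near: h; exact: nbhs_right_gt.
have h1 : h <= 1 by near: h; apply: nbhs_right_ltW.
have he : h <= e / (`|C| + 1).
  by near: h; apply: nbhs_right_ltW; rewrite divr_gt0.
have : `|a * h ^+ m| <= C * h ^+ n by near: h.
rewrite normrM [`|h ^+ m|]ger0_norm; last exact/exprn_ge0/ltW.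
rewrite -(subnK mn) addnS -addSn exprD mulrA ler_pM2r ?exprn_gt0 //.
move=> /le_trans; apply.
apply: (@le_trans _ _ ((`|C| + 1) * h)); last by rewrite mulrC -ler_pdivlMr.
apply: (@le_trans _ _ ((`|C| + 1) * h ^+ (n - m.+1).+1)).
  by rewrite ler_pM2r ?exprn_gt0 // (le_trans (ler_norm C)) // lerDl.
rewrite ler_pM2l // exprS ger_pMr //; exact: exprn_ile1 (ltW h0) h1.
Unshelve. all: by end_near.
Qed.

Lemma row_coord_le_norm (R : realType) (d : nat) (x : 'rV[R]_d) i :
  `|x 0 i| <= `|x|.
Proof.
rewrite [leRHS]mx_normrE.
exact: (@le_bigmax_cond _ _ _ _ (0, i) _ (fun k => `|x k.1 k.2|)).
Qed.

Section Method.
Variables (R : realType) (s : nat) (M : explicit_tdmm R s).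

Definition abscissa (i : 'I_s) : R := \sum_(j < s | (j < i)%N) tdA M i j.

(** The coefficient of [h^3] in the component [z] of stage [i]; for
    the exact solution at time [c_i h] it would be [c_i^3 / 6]. *)
Definition stage_cubic (i : 'I_s) : R :=
  \sum_(j < s | (j < i)%N) tdA M i j * (2^-1 * abscissa j ^+ 2) +
  \sum_(j < s | (j < i)%N) tdAhat M i j * abscissa j.

(** The same coefficient for the step; the exact solution has [1 / 6]. *)
Definition weight_cubic : R :=
  \sum_(j < s) tdb M j 0 * (2^-1 * abscissa j ^+ 2) +
  \sum_(j < s) tdbhat M j 0 * abscissa j.

Lemma sum_coord (d : nat) (P : pred 'I_s) (a : 'I_s -> R)
    (v : 'I_s -> 'rV[R]_d) k :
  (\sum_(j < s | P j) a j *: v j) 0 k = \sum_(j < s | P j) a j * v j 0 k.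
Proof. by rewrite summxE; apply: eq_bigr => j _; rewrite mxE. Qed.

Lemma test_sol0 : test_sol (0 : R) = 0.
Proof.
apply/rowP; apply: forall_I3; rewrite row3E mxE //.
by rewrite expr0n mulr0.
Qed.

(** No remainder terms occur: the test field is polynomial and triangular, so
    the components [x] and [z] of the stages are monomials in [h]. *)
Lemma test_stages h y : is_stages M (@test_field R) (test_sol 0) h y ->
  forall i, y i 0 ix = h * abscissa i /\ y i 0 iz = h ^+ 3 * stage_cubic i.
Proof.
rewrite test_sol0 => Hy.
have yx i : y i 0 ix = h * abscissa i.
  rewrite Hy !mxE !sum_coord.
  rewrite (eq_bigr (tdA M i)) => [|j _]; last by rewrite row3E mulr1.
  rewrite [X in _ + h ^+ 2 * X]big1 => [|j _]; last first.
    by rewrite test_Fdot row3E mulr0.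
  by rewrite mulr0 addr0 add0r.
move=> i; split=> //; rewrite Hy !mxE !sum_coord add0r /stage_cubic mulrDr.
rewrite !mulr_sumr; congr (_ + _); apply: eq_bigr => j _.
  by rewrite row3E yx; ring.
by rewrite test_Fdot row3E yx; ring.
Qed.

Lemma test_step h y : is_stages M (@test_field R) (test_sol 0) h y ->
  let x := step M (@test_field R) (test_sol 0) h y in
  x 0 iz = h ^+ 3 * weight_cubic /\
  x 0 iw = h ^+ 7 *
    \sum_(j < s) tdb M j 0 * (stage_cubic j - 6^-1 * abscissa j ^+ 3) ^+ 2.
Proof.
move=> /test_stages yE x; rewrite /x /step test_sol0.
split; rewrite !mxE !sum_coord add0r.
  rewrite /weight_cubic mulrDr !mulr_sumr; congr (_ + _); apply: eq_bigr => j _.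
    by rewrite row3E (yE j).1; ring.
  by rewrite test_Fdot row3E (yE j).1; ring.
rewrite [X in _ + h ^+ 2 * X]big1 => [|j _]; last first.
  by rewrite test_Fdot row3E mulr0.
rewrite mulr0 addr0 !mulr_sumr; apply: eq_bigr => j _.
by rewrite row3E (yE j).1 (yE j).2; ring.
Qed.

(** Each component of the error of the test problem is a monomial of degree at
    most 7 in [h], so its coefficient must vanish when the error is of size
    [h^8]. *)
Lemma order7_conditions : has_order M 7 ->
  6^-1 - weight_cubic = 0 /\
  \sum_(j < s) tdb M j 0 * (stage_cubic j - 6^-1 * abscissa j ^+ 3) ^+ 2 = 0.
Proof.
move=> /(_ _ _ (test_field_smooth R) (@test_sol R)) H.
have [y Hy] : exists y : R -> 'I_s -> 'rV[R]_3,
    forall h, is_stages M (@test_field R) (test_sol 0) h (y h).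
  have /boolp.choice[y Hy] h :=
    is_stages_exists M (@test_field R) (test_sol 0) h.
  by exists y.
have [|C HC] := H _ y Hy; first by near=> t; exact: test_sol_derive.
have coef0 a m i : (m < 8)%N -> (forall h,
    (test_sol h - step M (@test_field R) (test_sol 0) h (y h)) 0 i =
      a * h ^+ m) -> a = 0.
  move=> m8 aE; apply: (near0_pow_eq0 (C := C) m8); near=> h.
  rewrite -aE; apply: le_trans (row_coord_le_norm _ i) _.
  by near: h.
split.
  apply: (coef0 _ 3%N iz) => // h; have [sz _] := test_step (Hy h).
  by rewrite mxE [X in _ + X = _]mxE sz row3E; ring.
apply/eqP; rewrite -oppr_eq0; apply/eqP.
apply: (coef0 _ 7%N iw) => // h; have [_ sw] := test_step (Hy h).
by rewrite mxE [X in _ + X = _]mxE sw row3E; ring.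
Unshelve. all: by end_near.
Qed.

End Method.

Theorem theorem3 (R : realType) (s : nat) (M : explicit_tdmm R s) (K : R)
  (hK : 0 < K) (hirr : irreducible M) (hssp : ssp_ts M K) :
  ~ has_order M 7.
Proof.
move=> /order7_conditions[wc tau0].
have b0 := irreducible_ssp_weights_gt0 hK hirr hssp.
(* A vanishing sum of squares with positive weights. *)
have tau j : stage_cubic M j = 6^-1 * abscissa M j ^+ 3.
  move/eqP: tau0; rewrite psumr_eq0 => [/allP/(_ j (mem_index_enum _))|k _].
    by rewrite /= mulf_eq0 gt_eqF //= sqrf_eq0 subr_eq0 => /eqP.
  by rewrite mulr_ge0 ?sqr_ge0 // ltW.
(* Only earlier stages enter [stage_cubic M i], and they sit at time 0. *)
have c0 i : abscissa M i = 0.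
  have [n] := ubnP (val i); elim: n i => // n IH i /= ltin.
  have := tau i; rewrite /stage_cubic !big1 ?addr0.
  - by move/esym/eqP; rewrite mulf_eq0 expf_eq0 /= invr_eq0 pnatr_eq0 => /eqP.
  - by move=> j ji; rewrite IH ?mulr0 // (leq_trans ji).
  - by move=> j ji; rewrite IH ?expr0n ?mulr0 // (leq_trans ji).
move/eqP: wc; rewrite /weight_cubic !big1 ?addr0 ?subr0.
- by rewrite invr_eq0 pnatr_eq0.
- by move=> j _; rewrite c0 mulr0.
- by move=> j _; rewrite c0 expr0n !mulr0.
Qed.
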